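(* The basis of $SS_r$ for $GL(m|1)$ consists of the special elements $\tilde h_{a_1,\ldots,a_m|b}$ together with the elements $H_{a_1^{m_1}\ldots a_s^{m_s}|b}$, where $(a_1^{m_1}a_2^{m_2}\ldots a_s^{m_s}|b)$ is canonical. The dimension of $SS_r$ equals $$q\binom{q-\frac{q}{p}+m-1}{m}+\frac{q}{p}\binom{p+m-2}{m-1}.$$
   Context: $K$ is a field of characteristic $p>0$, $m\ge1$, $r\ge 1$, $q=p^r$. $T$ is the diagonal torus of $GL(m|1)$, $x_i=e_{ii}$ ($1\le i\le m$), $y_1=e_{m+1,m+1}$. $Dist(T)$ is the commutative $K$-algebra with basis $\prod_i\binom{x_i}{a_i}\cdot\binom{y_1}{b}$ ($a_i,b\ge0$), with multiplication obtained by tensoring with $K$ the ring of integer-valued polynomials over $\mathbb{Z}$. $Dist(T_r)$ is the subalgebra spanned by the basis monomials with all $a_i,b<q$. For $f\in Dist(T)$, $s_{i1}(f)$ is obtained by replacing $x_i$ by $x_i-1$ and $y_1$ by $y_1+1$, and $\Phi_{i1}(f)=f-s_{i1}(f)$. $SS_r$ is the set of all $f\in Dist(T_r)$ that are symmetric in $x_1,\ldots,x_m$ and such that for all $i$ there is $f'_{i}\in Dist(T_r)$ with $\Phi_{i1}(f)=(x_i+y_1)f'_{i}$. For $0\le a,b<q$ put $X_{i,a}=\sum_{k=a}^{q-1}(-1)^{k-a}\binom{k}{a}\binom{x_i}{k}$, $Y_{1,b}=\sum_{k=b}^{q-1}(-1)^{k-b}\binom{k}{b}\binom{y_1}{k}$,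 $h_{a_1,\ldots,a_m|b}=\prod_iX_{i,a_i}\cdot Y_{1,b}$. The special elements are $\tilde h_{a_1,\ldots,a_m|b}$ with $0\le a_i,b<q$ and no $a_i+b$ divisible by $p$, where $\tilde h_{a_1,\ldots,a_m|b}$ is the sum of the distinct elements $h_{a_{\sigma(1)},\ldots,a_{\sigma(m)}|b}$, $\sigma\in\Sigma_m$ (so it depends only on the multiset $\{a_i\}$ and on $b$). A canonical tuple $(a_1^{m_1}a_2^{m_2}\ldots a_s^{m_s}|b)$ is the tuple in which $a_k$ is repeated $m_k$ times, where $a_1=0<a_2<\cdots<a_s<p$, $m_1,\ldots,m_s>0$, $m_1+\cdots+m_s=m$, and $0\le b<q$ is divisible by $p$. On tuples $(a_1,\ldots,a_m|b)$ with $0\le a_i,b<q$ let $\sim$ be the equivalence relation generated by permutations of $a_1,\ldots,a_m$ and by $(a_1,a_2,\ldots,a_m|b)\sim(a_1',a_2,\ldots,a_m|b')$ whenever $a_1+b\equiv0\pmod p$ and $a_1+b\equiv a_1'+b'\pmod q$. Then $H_{a_1^{m_1}\ldots a_s^{m_s}|b}$ is the sum, each with multiplicity one, of all $h_{c_1,\ldots,c_m|c}$ with $(c_1,\ldots,c_m|c)\sim(a_1^{m_1}\ldots a_s^{m_s}|b)$. *)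

(* Defs.v *)
From HB Require Import structures.
From mathcomp Require Import all_boot all_order all_fingroup all_algebra.
From mathcomp Require Export freeg mpoly.

Set Implicit Arguments.
Unset Strict Implicit.
Unset Printing Implicit Defensive.

Import GRing.Theory Num.Theory.

Local Open Scope ring_scope.

Definition binvar n (i : 'I_n) (c : nat) : {mpoly rat[n]} :=
  c`!%:R^-1 *: \prod_(j < c) ('X_i - j%:R).

Definition binpoly n (a : 'X_{1..n}) : {mpoly rat[n]} :=
  \prod_(i < n) binvar i (a i).

Definition int_valued n (f : {mpoly rat[n]}) : Prop :=
  forall z : 'I_n -> int, f.@[fun i => (z i)%:~R] \is a Num.int.

(* t ^ d = \sum_c pow2bin d c * binom(t, c), because                          *)
(* t * binom(t, c) = c * binom(t, c) + (c + 1) * binom(t, c + 1).             *)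
Fixpoint pow2bin (d c : nat) : nat :=
  if d is d'.+1 then (c * (pow2bin d' c + pow2bin d' c.-1))%N else (c == 0)%N.

(* The coordinate of f on binpoly c, see binpoly_decomp; it is an integer     *)
(* when f is integer-valued.                                                  *)
Definition bincoef n (f : {mpoly rat[n]}) (c : 'X_{1..n}) : rat :=
  \sum_(d <- msupp f) f@_d * (\prod_(i < n) pow2bin (d i) (c i))%N%:R.

(* The K-algebra (integer-valued polynomials in n variables) (x)_Z K: the     *)
(* basis element << a >> stands for \prod_i binom(x_i, a i) (x) 1.  Its ring  *)
(* structure is installed below from dmul.                                    *)
Definition dist (K : fieldType) (n : nat) : Type := {freeg 'X_{1..n} / K}.

HB.instance Definition _ (K : fieldType) n :=
  GRing.Lmodule.copy (dist K n) {freeg 'X_{1..n} / K}.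

(* The image f (x) 1 of an integer-valued polynomial f; numq reads off the    *)
(* integer bincoef f c.                                                       *)
Definition tens1 (K : fieldType) n (f : {mpoly rat[n]}) : dist K n :=
  \sum_(c : {ffun 'I_n -> 'I_(msize f)})
    << (numq (bincoef f [multinom val (c i) | i < n]))%:~R
       *g [multinom val (c i) | i < n] >>.

Definition dmul (K : fieldType) n (f g : dist K n) : dist K n :=
  fglift (fun a => fglift (fun b => tens1 K (binpoly a * binpoly b)) g) f.

(* The K-linear extension of f (x) 1 |-> f(s_0, ..., s_(n-1)) (x) 1, see     *)
(* dsubst_tens1.                                                              *)
Definition dsubst (K : fieldType) n (s : n.-tuple {mpoly rat[n]})
    (f : dist K n) : dist K n :=
  fglift (fun a => tens1 K (binpoly a \mPo s)) f.

Section IntegerValued.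
Variable n : nat.
Implicit Types (f g : {mpoly rat[n]}) (a b k : 'X_{1..n}).

Lemma natr_neq0 (c : nat) : c.+1%:R != 0 :> rat.
Proof. by rewrite pnatr_eq0. Qed.

Lemma mulX_binvar (i : 'I_n) c :
  'X_i * binvar i c = c%:R *: binvar i c + c.+1%:R *: binvar i c.+1.
Proof.
rewrite /binvar big_ord_recr /= !scalerA factS natrM invfM mulrA.
rewrite divff ?natr_neq0 // mul1r -scalerAr [c%:R * _]mulrC -scalerA -scalerDr.
congr (_ *: _); rewrite mulrBr [_ * 'X_i]mulrC.
by rewrite scaler_nat mulr_natr addrC subrK.
Qed.

Lemma pow2bin0 d c : (d < c)%N -> pow2bin d c = 0%N.
Proof.
elim: d c => [|d IH] [|c] //= dc.
by rewrite (IH c dc) (IH c.+1 (leqW dc)) muln0.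
Qed.

Lemma expX_binvar (i : 'I_n) d N : (d < N)%N ->
  'X_i ^+ d = \sum_(c < N) (pow2bin d c)%:R *: binvar i c.
Proof.
elim: d N => [|d IH] [|N] // dN.
  rewrite expr0 big_ord_recl big1 /= ?addr0 => [|j _]; last by rewrite scale0r.
  by rewrite scale1r /binvar big_ord0 fact0 invr1 scale1r.
rewrite exprS (IH N) // mulr_sumr.
under eq_bigr do
  rewrite -scalerAr mulX_binvar scalerDr 2!(scalerA _ _ (binvar _ _)).
rewrite big_split /= [RHS]big_ord_recl /= mul0n scale0r add0r.
under [RHS]eq_bigr do rewrite add0n mulnDr natrD scalerDl.
rewrite [RHS]big_split /= addrC [RHS]addrC; congr (_ + _).
  by apply: eq_bigr => j _; rewrite natrM [_ * j.+1%:R]mulrC.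
case: N dN {IH} => [|N] // dN.
rewrite big_ord_recl /= mulr0 scale0r add0r big_ord_recr /=.
rewrite (pow2bin0 (c := N.+1)) // muln0 scale0r addr0.
by apply: eq_bigr => j _; rewrite /bump /= add1n natrM mulrC.
Qed.

Lemma binpoly_decomp f N : (msize f <= N)%N ->
  f = \sum_(c : {ffun 'I_n -> 'I_N})
        bincoef f [multinom val (c i) | i < n]
          *: binpoly [multinom val (c i) | i < n].
Proof.
move=> fN; rewrite {1}[f]mpolyE.
under [RHS]eq_bigr do rewrite /bincoef scaler_suml.
rewrite exchange_big /= [LHS]big_seq [RHS]big_seq; apply: eq_bigr => d df.
under eq_bigr do rewrite -scalerA.
rewrite -scaler_sumr; congr (_ *: _).
rewrite mpolyXE_id.
have dN i : (d i < N)%N.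
  apply: leq_trans fN; apply: leq_ltn_trans (msize_mdeg_lt df).
  by rewrite mdegE (bigD1 i) //= leq_addr.
under eq_bigr => i _ do rewrite (expX_binvar i (dN i)).
rewrite bigA_distr_bigA /=; apply: eq_bigr => c _.
rewrite scaler_prod natr_prod; congr (_ *: _).
  by apply: eq_bigr => i _; rewrite mnmE.
by apply: eq_bigr => i _; rewrite mnmE.
Qed.


Definition rbin (x : rat) (c : nat) : rat :=
  c`!%:R^-1 * \prod_(j < c) (x - j%:R).

Lemma rbinS x c : rbin (x + 1) c.+1 = rbin x c.+1 + rbin x c.
Proof.
rewrite /rbin [in LHS]big_ord_recl [in X in _ = X + _]big_ord_recr /= subr0.
rewrite (eq_bigr (fun j : 'I_c => x - j%:R)); last first.
  by move=> j _; rewrite /bump /= add1n -natr1 opprD addrACA subrr addr0.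
set P := \prod_(j < c) _; have -> : x + 1 = (x - c%:R) + c.+1%:R.
  by rewrite -natr1 addrA subrK.
rewrite mulrDl mulrDr [P * _]mulrC; congr (_ + _).
by rewrite factS natrM invfM mulrACA mulVf ?mul1r // pnatr_eq0.
Qed.

Lemma rbin0r x : rbin x 0 = 1.
Proof. by rewrite /rbin big_ord0 fact0 invr1 mulr1. Qed.

Lemma rbin_nat (t c : nat) : rbin t%:R c = 'C(t, c)%:R.
Proof.
elim: t c => [|t IH] [|c]; rewrite ?bin0 ?rbin0r //.
  by rewrite /rbin big_ord_recl /= subr0 mul0r mulr0.
by rewrite -natr1 rbinS !IH binS natrD.
Qed.

Lemma rbin_int (z : int) c : rbin z%:~R c \is a Num.int.
Proof.
elim: c z => [|c IHc] z; first by rewrite rbin0r.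
elim: z => [|t IHt|t IHt]; first by rewrite (rbin_nat 0 c.+1).
  by rewrite -addn1 PoszD intrD rbinS rpredD.
have := rbinS (- t.+1%:Z)%:~R c.
have -> : (- t.+1%:Z)%:~R + 1 = (- t%:Z)%:~R :> rat.
  by rewrite -[1]/(1%:~R) -intrD -addn1 PoszD opprD subrK.
by move/(canLR (addrK _)) <-; rewrite rpredB.
Qed.

Lemma meval_binpoly v a :
  (binpoly a).@[v] = \prod_(i < n) rbin (v i) (a i).
Proof.
rewrite /binpoly rmorph_prod; apply: eq_bigr => i _ /=.
rewrite /binvar mevalZ rmorph_prod; congr (_ * _); apply: eq_bigr => j _ /=.
by rewrite mevalB mevalXU rmorph_nat.
Qed.

Lemma binpoly_int a : int_valued (binpoly a).
Proof.
move=> z; rewrite meval_binpoly; apply: rpred_prod => i _; exact: rbin_int.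
Qed.

Lemma int_valuedM f g : int_valued f -> int_valued g -> int_valued (f * g).
Proof. by move=> fi gi z; rewrite mevalM rpredM. Qed.

Lemma int_valued_comp f (s : n.-tuple {mpoly rat[n]}) :
  int_valued f -> (forall i, int_valued (tnth s i)) -> int_valued (f \mPo s).
Proof.
move=> fi si z; rewrite comp_mpoly_meval.
have /all_tag [t st] i : {t : int | (tnth s i).@[fun j => (z j)%:~R] = t%:~R}.
  by exists (numq (tnth s i).@[fun j => (z j)%:~R]); rewrite numqK ?si.
by rewrite (meval_eq (v2 := fun i => (t i)%:~R)).
Qed.

Definition nbin k a : nat := (\prod_(i < n) 'C(k i, a i))%N.

Lemma meval_binpoly_nat k a :
  (binpoly a).@[fun i => (k i)%:R] = (nbin k a)%:R.
Proof.
by rewrite meval_binpoly natr_prod; apply: eq_bigr => i _; rewrite rbin_nat.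
Qed.

Lemma nbinn k : nbin k k = 1%N.
Proof. by rewrite /nbin big1 // => i _; rewrite binn. Qed.

Lemma nbin_small k a : a != k -> (mdeg k <= mdeg a)%N -> nbin k a = 0%N.
Proof.
move=> ak ka; apply/eqP; apply: contraNT ak; rewrite -lt0n => nz.
have le_ak : (a <= k)%MM.
  apply/mnm_lepP => i; rewrite leqNgt; apply: contraTN nz => /bin_small ki.
  by rewrite /nbin (bigD1 i) //= ki mul0n.
move: ka; rewrite -(submK le_ak) mdegD -{2}[mdeg a]add0n leq_add2r leqn0.
by rewrite mdeg_eq0 => /eqP ->; rewrite add0m.
Qed.

Lemma meval_bincoef f N k : (msize f <= N)%N ->
  f.@[fun i => (k i)%:R] = \sum_(c : {ffun 'I_n -> 'I_N})
    bincoef f [multinom val (c i) | i < n]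
      * (nbin k [multinom val (c i) | i < n])%:R.
Proof.
move=> fN; rewrite {1}(binpoly_decomp fN) raddf_sum; apply: eq_bigr => c _ /=.
by rewrite mevalZ meval_binpoly_nat.
Qed.

Lemma bincoef_int f c : int_valued f -> bincoef f c \is a Num.int.
Proof.
move=> fi; have [b] := ubnP (mdeg c); elim: b c => // b IH c.
rewrite ltnS => cb; have fc : f.@[fun i => (c i)%:R] \is a Num.int.
  exact: (fi (fun i => c i)).
pose N := maxn (msize f) (mdeg c).+1.
have cN i : (c i < N)%N.
  by rewrite leq_max ltnS mdegE (bigD1 i) //= leq_addr orbT.
move: fc; rewrite (meval_bincoef c (leq_maxl _ (mdeg c).+1)) -/N.
rewrite (bigD1 [ffun i => Ordinal (cN i)]) //=.
have -> : [multinom val ([ffun i => Ordinal (cN i)] i) | i < n] = c.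
  by apply/mnmP => i; rewrite mnmE ffunE.
rewrite nbinn mulr1 rpredDr //; apply: rpred_sum => e ne.
set e' := [multinom _ | i < n].
have [ec|ce] := ltnP (mdeg e') (mdeg c).
  by rewrite rpredM ?(IH _ (leq_trans ec cb)) ?rpred_nat.
rewrite nbin_small ?mulr0 // ; apply: contraNneq ne => ee.
apply/eqP/ffunP => i; apply/val_inj; rewrite ffunE /= -ee mnmE //.
Qed.

End IntegerValued.

HB.instance Definition _ (R : nzRingType) (T : choiceType) (M : lmodType R)
  (f : T -> M) := GRing.isZmodMorphism.Build {freeg T / R} M (fglift f)
  (lift_is_additive f).

Section DistAlgebra.
Variables (K : fieldType) (n : nat).
Implicit Types (f g : {mpoly rat[n]}) (a b k : 'X_{1..n}) (D E : dist K n).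

Lemma fgliftE (M : lmodType K) (F : 'X_{1..n} -> M) D :
  fglift F D = \sum_(a <- dom D) coeff a D *: F a.
Proof.
rewrite -{1}[D]freeg_sumE raddf_sum; apply: eq_bigr => a _.
by rewrite /= liftU.
Qed.

Lemma fglift_is_scalable (M : lmodType K) (F : 'X_{1..n} -> M) (x : K) D :
  fglift F (x *: D) = x *: fglift F D.
Proof.
rewrite -{1}[D]freeg_sumE scaler_sumr raddf_sum fgliftE scaler_sumr.
apply: eq_bigr => a _ /=; rewrite scalerA.
suff -> : x *: << coeff a D *g a >> = << x * coeff a D *g a >> by rewrite liftU.
by apply/eqP/freeg_eqP => b; rewrite coeffZ !coeffU mulrA.
Qed.

HB.instance Definition _ (M : lmodType K) (F : 'X_{1..n} -> M) :=
  GRing.isScalable.Build K (dist K n) M *:%R (fglift F)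
    (fglift_is_scalable F).

(* The value of D, reduced to K, at the point k of N ^ n. *)
Definition dval k D : K := fglift (fun a => (nbin k a)%:R : K^o) D.


Fact dval_is_zmod_morphism k : zmod_morphism (dval k).
Proof. move=> D E; exact: (@lift_is_additive K _ K^o _ D E). Qed.

Fact dval_is_scalable k : scalable_for *%R (dval k).
Proof. move=> x D; rewrite /dval fglift_is_scalable. by []. Qed.

HB.instance Definition _ k :=
  GRing.isZmodMorphism.Build (dist K n) K (dval k) (dval_is_zmod_morphism k).
HB.instance Definition _ k :=
  GRing.isScalable.Build K (dist K n) K *%R (dval k) (dval_is_scalable k).

Lemma dvalU k x a : dval k << x *g a >> = x * (nbin k a)%:R.
Proof. by rewrite /dval liftU. Qed.

Lemma dval_inj D E : (forall k, dval k D = dval k E) -> D = E.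
Proof.
move=> eqDE; apply/eqP; rewrite -subr_eq0; set F := D - E.
have F0 k : dval k F = 0 by rewrite raddfB /= eqDE subrr.
suff F0' a : coeff a F = 0 by apply/freeg_eqP => a; rewrite F0' coeff0.
have [b] := ubnP (mdeg a); elim: b a => // b IH a; rewrite ltnS => ab.
have := F0 a; rewrite /dval fgliftE.
have [aF|/coeff_outdom //] := boolP (a \in dom F).
rewrite (bigD1_seq a) ?uniq_dom //= nbinn [_ *: _]mulr1 big1 ?addr0 // => e ea.
have [lt|le] := ltnP (mdeg e) (mdeg a).
  by rewrite IH ?scale0r // (leq_trans lt).
by rewrite nbin_small // scaler0.
Qed.

Lemma numqD_int (x y : rat) : x \is a Num.int -> y \is a Num.int ->
  numq (x + y) = numq x + numq y.
Proof. by move=> /intrP[u ->] /intrP[v ->]; rewrite -intrD !numq_int. Qed.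

Lemma numqM_int (x y : rat) : x \is a Num.int -> y \is a Num.int ->
  numq (x * y) = numq x * numq y.
Proof. by move=> /intrP[u ->] /intrP[v ->]; rewrite -intrM !numq_int. Qed.

Lemma numq_nat (t : nat) : numq t%:R = t.
Proof. exact: (numq_int t). Qed.

Lemma numq_sum_int (I : finType) (F : I -> rat) :
  (forall i, F i \is a Num.int) -> numq (\sum_i F i) = \sum_i numq (F i).
Proof.
move=> Fi; suff [] : \sum_i F i \is a Num.int
  /\ numq (\sum_i F i) = \sum_i numq (F i) by [].
elim/big_rec2: _ => [|i u v _ [vi <-]]; first by [].
by rewrite numqD_int // rpredD.
Qed.

Lemma dval_tens1 k f : int_valued f ->
  dval k (tens1 K f) = (numq f.@[fun i => (k i)%:R])%:~R.
Proof.
move=> fi; rewrite (meval_bincoef k (leqnn _)) raddf_sum numq_sum_int.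
  rewrite (rmorph_sum (intmul 1)); apply: eq_bigr => c _ /=.
  by rewrite dvalU numqM_int ?rpred_nat ?bincoef_int // numq_nat intrM.
by move=> c; rewrite rpredM ?rpred_nat ?bincoef_int.
Qed.

Lemma tens1_binpoly a : tens1 K (binpoly a) = << a >>.
Proof.
apply: dval_inj => k; rewrite dval_tens1; last exact: binpoly_int.
by rewrite meval_binpoly_nat numq_nat dvalU mul1r.
Qed.

Lemma dval_fglift k (F : 'X_{1..n} -> dist K n) D :
  dval k (fglift F D) = \sum_(a <- dom D) coeff a D * dval k (F a).
Proof.
rewrite fgliftE raddf_sum; apply: eq_bigr => a _.
by rewrite /= dval_is_scalable.
Qed.

Lemma dvalE k D : dval k D = \sum_(a <- dom D) coeff a D * (nbin k a)%:R.
Proof. by rewrite /dval fgliftE. Qed.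

Lemma dval_dmul k D E : dval k (dmul D E) = dval k D * dval k E.
Proof.
rewrite dval_fglift [dval k D]dvalE mulr_suml; apply: eq_bigr => a _.
rewrite dval_fglift -mulrA dvalE !mulr_sumr; apply: eq_bigr => b _.
rewrite dval_tens1; last by apply: int_valuedM; apply: binpoly_int.
rewrite mevalM !meval_binpoly_nat numqM_int ?rpred_nat //.
rewrite !numq_nat intrM -!pmulrn.
by congr (_ * _); rewrite mulrCA.
Qed.

Definition dist1 : dist K n := << 0%MM >>.

Lemma dval_1 k : dval k dist1 = 1.
Proof. by rewrite dvalU mul1r /nbin big1 // => i _; rewrite mnm0E bin0. Qed.

Fact dmulA : associative (@dmul K n).
Proof. by move=> x y z; apply: dval_inj => k; rewrite !dval_dmul mulrA. Qed.

Fact dmulC : commutative (@dmul K n).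
Proof. by move=> x y; apply: dval_inj => k; rewrite !dval_dmul mulrC. Qed.

Fact dmul1d : left_id dist1 (@dmul K n).
Proof. by move=> x; apply: dval_inj => k; rewrite dval_dmul dval_1 mul1r. Qed.

Fact dmulDl : left_distributive (@dmul K n) +%R.
Proof.
move=> x y z; apply: dval_inj => k.
by rewrite raddfD /= !dval_dmul raddfD /= mulrDl.
Qed.

Fact dist1_neq0 : dist1 != 0.
Proof.
apply/eqP => /(congr1 (dval 0%MM)); rewrite dval_1 raddf0 => /eqP.
by rewrite oner_eq0.
Qed.

HB.instance Definition _ := GRing.Zmodule_isComNzRing.Build (dist K n)
  dmulA dmulC dmul1d dmulDl dist1_neq0.

Lemma dval_is_monoid_morphism k : monoid_morphism (dval k).
Proof. by split; [exact: dval_1 | exact: dval_dmul]. Qed.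

HB.instance Definition _ k :=
  GRing.isMonoidMorphism.Build (dist K n) K (dval k)
    (dval_is_monoid_morphism k).

Fact dscaleAl (x : K) D E : x *: (D * E) = x *: D * E.
Proof.
apply: dval_inj => k.
by rewrite dval_is_scalable !rmorphM /= dval_is_scalable mulrA.
Qed.

HB.instance Definition _ := GRing.Lmodule_isLalgebra.Build K (dist K n)
  dscaleAl.
HB.instance Definition _ := GRing.Lalgebra_isComAlgebra.Build K (dist K n).

Lemma tens1M f g : int_valued f -> int_valued g ->
  tens1 K (f * g) = tens1 K f * tens1 K g.
Proof.
move=> fi gi; apply: dval_inj => k; rewrite rmorphM /=.
rewrite !dval_tens1 //; last exact: int_valuedM.
by rewrite mevalM numqM_int ?intrM //;
  [exact: (fi (fun i => k i)) | exact: (gi (fun i => k i))].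
Qed.

Lemma dsubst_tens1 (s : n.-tuple {mpoly rat[n]}) f :
  int_valued f -> (forall i, int_valued (tnth s i)) ->
  dsubst s (tens1 K f) = tens1 K (f \mPo s).
Proof.
move=> fi si; apply: dval_inj => k.
rewrite dval_tens1; last exact: int_valued_comp.
have si_k a : (binpoly a \mPo s).@[fun i => (k i)%:R] \is a Num.int.
  exact: (int_valued_comp (binpoly_int a) si (fun i => k i)).
have -> : (f \mPo s).@[fun i => (k i)%:R] =
    \sum_(c : {ffun 'I_n -> 'I_(msize f)})
      bincoef f [multinom val (c i) | i < n]
      * (binpoly [multinom val (c i) | i < n] \mPo s).@[fun i => (k i)%:R].
  rewrite {1}(binpoly_decomp (leqnn (msize f))) (raddf_sum (comp_mpoly s)).
  rewrite (raddf_sum (meval _)) /=.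
  by apply: eq_bigr => c _; rewrite comp_mpolyZ mevalZ.
rewrite numq_sum_int => [|c]; last by rewrite rpredM ?bincoef_int.
rewrite (rmorph_sum (intmul 1)) /dsubst {2}/tens1.
rewrite (raddf_sum (fglift _)) raddf_sum.
apply: eq_bigr => c _ /=; rewrite numqM_int ?bincoef_int // intrM liftU.
rewrite dval_is_scalable dval_tens1 //.
exact: int_valued_comp (binpoly_int _) si.
Qed.

End DistAlgebra.

(* For the diagonal torus T of GL(m|1), Dist(T) is dist K m.+1; its variables *)
(* are x_1, ..., x_m, y_1 in this order.                                      *)
Definition xvar m (i : 'I_m) : 'I_m.+1 := fintype.lift ord_max i.
Definition yvar m : 'I_m.+1 := ord_max.

Definition dbin (K : fieldType) n (i : 'I_n) (k : nat) : dist K n :=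
  << (U_(i) *+ k)%MM >>.

Definition in_distr (K : fieldType) n (q : nat) (f : dist K n) : Prop :=
  forall a, a \in dom f -> forall i, (a i < q)%N.

Definition permx m (s : 'S_m) : m.+1.-tuple {mpoly rat[m.+1]} :=
  [tuple 'X_(lift_perm (yvar m) (yvar m) s j) | j < m.+1].

Definition shiftx m (i : 'I_m) : m.+1.-tuple {mpoly rat[m.+1]} :=
  [tuple if j == xvar i then 'X_j - 1
         else if j == yvar m then 'X_j + 1 else 'X_j | j < m.+1].

Lemma permx_int m (s : 'S_m) j : int_valued (tnth (permx s) j).
Proof. by move=> z; rewrite tnth_mktuple mevalXU intr_int. Qed.

Lemma shiftx_int m (i : 'I_m) j : int_valued (tnth (shiftx i) j).
Proof.
move=> z; rewrite tnth_mktuple; case: ifP => _; last case: ifP => _.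
- by rewrite mevalB mevalXU meval1 rpredB ?intr_int.
- by rewrite mevalD mevalXU meval1 rpredD ?intr_int.
- by rewrite mevalXU intr_int.
Qed.

Definition Phi (K : fieldType) m (i : 'I_m) (f : dist K m.+1) : dist K m.+1 :=
  f - dsubst (shiftx i) f.

Definition SS (K : fieldType) m (q : nat) (f : dist K m.+1) : Prop :=
  [/\ in_distr q f,
      forall s : 'S_m, dsubst (permx s) f = f
    & forall i : 'I_m, exists2 f' : dist K m.+1, in_distr q f'
        & Phi i f = (dbin K (xvar i) 1 + dbin K (yvar m) 1) * f'].

(* X_(i,a) for i = xvar _, and Y_(1,a) for i = yvar _.                        *)
Definition dXY (K : fieldType) n (q : nat) (i : 'I_n) (a : nat) : dist K n :=
  \sum_(a <= k < q) ((-1) ^+ (k - a) *+ 'C(k, a)) *: dbin K i k.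

(* A tuple (a_1, ..., a_m | b) with entries in [0, q).                        *)
Definition ptuple (m q : nat) : Type := (m.-tuple 'I_q * 'I_q)%type.
HB.instance Definition _ m q := Finite.copy (ptuple m q)
  (m.-tuple 'I_q * 'I_q)%type.

Definition entries m q (t : ptuple m q) : seq nat := map val t.1.

Definition helt (K : fieldType) m q (t : ptuple m q) : dist K m.+1 :=
  (\prod_(i < m) dXY K q (xvar i) (tnth t.1 i)) * dXY K q (yvar m) t.2.

Definition ptuple_perm m q (s : 'S_m) (t : ptuple m q) : ptuple m q :=
  ([tuple tnth t.1 (s i) | i < m], t.2).

Definition htilde (K : fieldType) m q (t : ptuple m q) : dist K m.+1 :=
  \sum_(v <- undup [seq helt K (ptuple_perm s t) | s : 'S_m]) v.

(* Nondecreasing tuples represent the multisets {a_1, ..., a_m}.              *)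
Definition special p m q (t : ptuple m q) : bool :=
  sorted leq (entries t) && all (fun a => ~~ (p %| a + t.2)%N) (entries t).

Definition tstep p m q (t u : ptuple m q) : bool :=
     (perm_eq t.1 u.1 && (t.2 == u.2))
  || [&& behead t.1 == behead u.1 :> seq _,
         (p %| head 0 (entries t) + t.2)%N
       & head 0%N (entries t) + t.2 == head 0%N (entries u) + u.2 %[mod q]].

Definition tequiv p m q (t u : ptuple m q) : bool :=
  connect [rel v w | tstep p v w || tstep p w v] t u.

(* Since 0 = a_1 < a_2 < ... < a_s < p, the tuples a_1^m_1 ... a_s^m_s are the*)
(* nondecreasing ones that start with 0 and have entries < p.                 *)
Definition canonical p m q (t : ptuple m q) : bool :=
  [&& sorted leq (entries t), head p (entries t) == 0%N,
      all (fun a => a < p)%N (entries t) & (p %| t.2)%N].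

Definition Helt (K : fieldType) p m q (t : ptuple m q) : dist K m.+1 :=
  \sum_(u : ptuple m q | tequiv p t u) helt K u.

Definition SS_family (K : fieldType) p m q
    (t : {t : ptuple m q | special p t} + {t : ptuple m q | canonical p t}) :
    dist K m.+1 :=
  match t with
  | inl t => htilde K (val t)
  | inr t => Helt K p (val t)
  end.

Definition is_basis (K : fieldType) (V : lmodType K) (S : V -> Prop)
    (I : finType) (b : I -> V) : Prop :=
  (forall c : I -> K, \sum_i c i *: b i = 0 -> forall i, c i = 0) /\
  (forall v, S v <-> exists c : I -> K, v = \sum_i c i *: b i).

Definition has_dim (K : fieldType) (V : lmodType K) (S : V -> Prop) (d : nat) :
    Prop :=
  exists b : 'I_d -> V, is_basis S b.

(* Main.v *)
Require Import Defs.
From HB Require Import structures.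
From mathcomp Require Import all_boot all_order all_fingroup all_algebra.
From mathcomp Require Import zify ring.

Set Implicit Arguments.
Unset Strict Implicit.
Unset Printing Implicit Defensive.

Import GRing.Theory.

Local Open Scope ring_scope.

(** Write [q = p ^ r].  An element of [Dist(T)] is determined by its values
    [dval] at the points of [N ^ (m + 1)].  For [c < q] the function
    [x |-> C(x, c)] is [q]-periodic modulo [p], so an element of [Dist(T_r)] is
    a [K]-valued function on [(Z / q) ^ (m + 1)].  Conversely, periodic values
    force an element into [Dist(T_r)] ([in_distrP]), and every function occurs
    because [helt t] is the indicator of the point [t] ([dval_helt]).

    In this language supersymmetry is an invariance condition.  Symmetry says
    that the values do not change when the [x_i] are permuted.  The equation
    [f - s_(i1)(f) = (x_i + y_1) f'] can be solved for [f'] point by point as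
    soon as its left-hand side vanishes where [x_i + y_1 = 0] in [K]; so it says
    that [f] takes the same value at [t] and at the point with [t_i - 1] and
    [b + 1], whenever [p] divides [t_i + b].  Iterating these unit shifts gives
    all the moves that preserve [t_i + b] modulo [q] ([shift_invariant_move]),
    that is, the steps of the equivalence [tequiv].  Hence [SS] consists of the
    functions that are constant on the classes of [tequiv]
    ([SS_invariantP]), and the indicators of the classes are a basis.

    It remains to see that each class contains exactly one tuple that is
    special or canonical.  A tuple in which no [t_i + b] is divisible by [p]
    can only be permuted, so its class contains one sorted tuple, a special
    one.  Otherwise some entry can be moved to [0], which makes [b] divisible
    by [p], and this entry serves to reduce the others modulo [p]
    ([tequiv_representative]).  Two canonical tuples in one class agree
    because of two invariants: the sum of all entries modulo [q], and, for each
    residue, the number of entries in it, less one for the residue of [-b]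
    ([core]).

    The dimension then counts sorted tuples.  For each [b] there are [q - q / p]
    admissible entries for a special tuple; a canonical tuple is [0] followed by
    a sorted tuple of [m - 1] entries below [p], and a multiple [b] of [p]. *)

(** * Binomial coefficients modulo p *)

Lemma q_gt0 p r : prime p -> (0 < p ^ r)%N.
Proof. by move=> p_pr; rewrite expn_gt0 prime_gt0. Qed.

Definition modq p r (p_pr : prime p) (k : nat) : 'I_(p ^ r) :=
  Ordinal (ltn_pmod k (q_gt0 r p_pr)).

Lemma modq_small p r (p_pr : prime p) (a : 'I_(p ^ r)) : modq r p_pr a = a.
Proof. by apply: val_inj; rewrite /= modn_small. Qed.

Section BinomialPeriodicity.
Variables (K : fieldType) (p r : nat).
Hypothesis charKp : p \in [pchar K].
Local Notation q := (p ^ r)%N.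

Lemma p_prime : prime p. Proof. by case/andP: charKp. Qed.

(** Since [c C(q, c) = q C(q - 1, c - 1)], were [C(q, c)] prime to [p], then
    [q] would divide [c]. *)
Lemma dvdp_bin_q c : (0 < c < q)%N -> (p %| 'C(q, c))%N.
Proof.
case: c => // c /= cq; apply: contraLR cq => pC; rewrite -leqNgt.
apply: dvdn_leq => //.
rewrite -(@Gauss_dvdl q c.+1 'C(q, c.+1)).
  by rewrite -mul_bin_diag dvdn_mulr.
by rewrite coprimeXl // prime_coprime ?p_prime.
Qed.

Definition zbin (z : int) (c : nat) : int := numq (rbin z%:~R c).

Lemma zbinK z c : rbin z%:~R c = (zbin z c)%:~R.
Proof. by rewrite /zbin numqK ?rbin_int. Qed.

Lemma zbin_nat (t c : nat) : zbin t c = 'C(t, c).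
Proof. by rewrite /zbin [_%:~R](_ : _ = t%:R) // rbin_nat numq_nat. Qed.

Lemma zbinS (z : int) c : zbin (z + 1) c.+1 = zbin z c.+1 + zbin z c.
Proof. by rewrite /zbin intrD rbinS numqD_int ?rbin_int. Qed.

Lemma int_const (T : Type) (g : int -> T) :
  (forall z, g (z + 1) = g z) -> forall z, g z = g 0.
Proof.
move=> gS; elim=> [//|n IH|n IH]; first by rewrite -addn1 PoszD gS.
by rewrite -IH -gS -addn1 PoszD opprD subrK.
Qed.

(** By Pascal's rule and induction on [c], the difference of the two sides
    does not depend on [z]; at [z = 0] it is [C(q, c)], which vanishes. *)
Lemma zbin_addq (z : int) c : (c < q)%N ->
  (zbin (z + q%:Z) c)%:~R = (zbin z c)%:~R :> K.
Proof.
elim: c z => [|c IH] z cq.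
  by rewrite /zbin !rbin0r.
apply/eqP; rewrite -subr_eq0.
pose g (z : int) := (zbin (z + q%:Z) c.+1)%:~R - (zbin z c.+1)%:~R : K.
rewrite -/(g z) (@int_const _ g) => [|y]; rewrite /g.
  rewrite add0r !zbin_nat bin0n subr0 -pmulrn -(dvdn_pcharf charKp).
  exact: dvdp_bin_q.
rewrite addrAC !zbinS !intrD (IH y (ltnW cq)).
by rewrite opprD addrACA subrr addr0.
Qed.

Lemma zbin_modq (z z' : int) c : (c < q)%N -> (z = z' %[mod q])%Z ->
  (zbin z c)%:~R = (zbin z' c)%:~R :> K.
Proof.
move=> cq zz.
have modq y : (zbin y c)%:~R = (zbin (y %% q)%Z c)%:~R :> K.
  rewrite {1}(divz_eq y q) addrC.
  pose g (j : int) := (zbin ((y %% q)%Z + j * q%:Z) c)%:~R : K.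
  rewrite -/(g (y %/ q)%Z) (@int_const _ g) => [|j]; rewrite /g.
    by rewrite mul0r addr0.
  by rewrite mulrDl mul1r addrA zbin_addq.
by rewrite modq zz -modq.
Qed.

Lemma bin_modq k k' c : (c < q)%N -> k = k' %[mod q] ->
  'C(k, c)%:R = 'C(k', c)%:R :> K.
Proof.
move=> cq kk; rewrite !pmulrn -!zbin_nat; apply: zbin_modq => //.
by rewrite !modz_nat kk.
Qed.

Lemma bin_trinomial x k a : (a <= k)%N -> (k <= x)%N ->
  ('C(x, k) * 'C(k, a) = 'C(x, a) * 'C(x - a, k - a))%N.
Proof.
move=> ak kx.
have e1 := bin_fact kx; have e2 := bin_fact ak.
have e3 := bin_fact (leq_trans ak kx).
have e4 : (k - a <= x - a)%N by exact: leq_sub2r.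
have {e4} := bin_fact e4.
rewrite (_ : x - a - (k - a) = x - k)%N => [e4|]; last lia.
apply/eqP; rewrite -(eqn_pmul2r (fact_gt0 a)).
rewrite -(eqn_pmul2r (fact_gt0 (k - a))) -(eqn_pmul2r (fact_gt0 (x - k))).
by apply/eqP; nia.
Qed.

(** For [x < q] this is the expansion of [(1 - 1) ^ (x - a)], after the
    trinomial revision [C(x, k) C(k, a) = C(x, a) C(x - a, k - a)]. *)
Lemma sum_bin_delta x a : (a < q)%N ->
  \sum_(k < q) ((-1) ^+ (k - a) *+ 'C(k, a)) * 'C(x, k)%:R
    = (x %% q == a)%N%:R :> K.
Proof.
move=> aq; set y := (x %% q)%N.
have yq : (y < q)%N by rewrite ltn_mod q_gt0 ?p_prime.
under eq_bigr => k _ do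
  rewrite (@bin_modq x y k (ltn_ord k)) ?modn_mod //.
rewrite -(big_mkord xpredT
  (fun k => ((-1) ^+ (k - a) *+ 'C(k, a)) * 'C(y, k)%:R)).
rewrite (@big_cat_nat _ _ _ a 0 q xpredT _ (leq0n a) (ltnW aq)) /=.
rewrite big_nat_cond big1 ?add0r => [|k]; last first.
  by rewrite andbT /= => ka; rewrite bin_small // mul0r.
have [ya|ay] := ltnP y a.
  rewrite (ltn_eqF ya) big_nat_cond big1 // => k; rewrite andbT => /andP[ak _].
  by rewrite (@bin_small y) ?mulr0 // (leq_trans ya).
rewrite (@big_cat_nat _ _ _ y.+1 a q xpredT _ (leqW ay) yq) /=.
rewrite [X in _ + X]big_nat_cond [X in _ + X]big1 ?addr0 => [|k]; last first.
  by rewrite andbT => /andP[ak _]; rewrite (@bin_small y) ?mulr0.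
rewrite -{1}[a]add0n big_addn subSn // big_mkord.
under eq_bigr => i _.
  have iy : (i + a <= y)%N by have := ltn_ord i; lia.
  rewrite addnK -mulr_natl -mulrA mulrCA -natrM mulnC.
  rewrite bin_trinomial ?leq_addl // addnK natrM mulrCA.
  over.
rewrite -mulr_sumr.
have -> : \sum_(i < (y - a).+1) (-1) ^+ i * 'C(y - a, i)%:R
          = (1 - 1 : K) ^+ (y - a).
  rewrite exprBn; apply: eq_bigr => i _.
  by rewrite !expr1n !mulr1 mulr_natr.
rewrite subrr expr0n subn_eq0 eqn_leq ay andbT.
by case: leqP => [ya|_]; rewrite ?mulr0 // (_ : y = a) ?binn ?mulr1 //; lia.
Qed.

End BinomialPeriodicity.

Lemma ptuple_eq m q (t u : ptuple m q) :
  (forall i, tnth t.1 i = tnth u.1 i) -> t.2 = u.2 -> t = u.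
Proof.
by case: t u => [t b] [u c] /= tu ->; congr (_, _); apply: eq_from_tnth.
Qed.

(** * The bounded subalgebra as an algebra of functions modulo q *)

Section Functions.
Variables (K : fieldType) (p r : nat).
Hypothesis charKp : p \in [pchar K].
Local Notation q := (p ^ r)%N.

Lemma prod_natb (R : comNzRingType) (I : finType) (b : pred I) :
  \prod_i (b i)%:R = [forall i, b i]%:R :> R.
Proof.
case: forallP => [bT | /forallP]; first by rewrite big1 // => i _; rewrite bT.
rewrite negb_forall => /existsP[i /negbTE bi].
by rewrite (bigD1 i) //= bi mul0r.
Qed.

Lemma dval_modq n (f : dist K n) (k k' : 'X_{1..n}) : in_distr q f ->
  (forall i, k i = k' i %[mod q]) -> dval k f = dval k' f.
Proof.
move=> fq kk; rewrite !dvalE; apply: eq_big_seq => a af; congr (_ * _).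
by rewrite !natr_prod; apply: eq_bigr => i _; apply: (bin_modq charKp); auto.
Qed.

(** Substitution is evaluation at another point.  That point may have
    negative coordinates, as happens for [x_i - 1] at [x_i = 0], but only its
    class [k'] modulo [q] matters. *)
Lemma dval_dsubst n (s : n.-tuple {mpoly rat[n]}) (f : dist K n)
    (k k' : 'X_{1..n}) (z : 'I_n -> int) :
  (forall i, int_valued (tnth s i)) -> in_distr q f ->
  (forall i, (tnth s i).@[fun j => (k j)%:R] = (z i)%:~R) ->
  (forall i, z i = k' i %[mod q])%Z ->
  dval k (dsubst s f) = dval k' f.
Proof.
move=> si fq sz zk; rewrite dval_fglift dvalE; apply: eq_big_seq => a af.
congr (_ * _); rewrite dval_tens1; last first.
  exact: int_valued_comp (@binpoly_int _ a) si.
rewrite comp_mpoly_meval meval_binpoly.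
under eq_bigr => i _ do rewrite sz zbinK.
rewrite -rmorph_prod numq_int rmorph_prod natr_prod.
apply: eq_bigr => i _; rewrite pmulrn -zbin_nat.
by apply: (zbin_modq charKp); auto.
Qed.

(** Values that are periodic modulo [q] are interpolated by the explicit
    bounded elements [e t] below, which are the indicators of the points [t]
    modulo [q]; so periodicity characterizes the bounded subalgebra. *)
Lemma in_distrP n (f : dist K n) :
  in_distr q f <->
  forall k k' : 'X_{1..n},
    (forall i, k i = k' i %[mod q]) -> dval k f = dval k' f.
Proof.
split=> [fq k k' | fper]; first exact: dval_modq.
pose mn (c : {ffun 'I_n -> 'I_q}) := [multinom val (c i) | i < n].
pose e (t : {ffun 'I_n -> 'I_q}) : dist K n :=
  \sum_(c : {ffun 'I_n -> 'I_q})
    << \prod_(i < n) ((-1) ^+ (c i - t i) *+ 'C(c i, t i)) *g mn c >>.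
have dval_e k t : dval k (e t) = [forall i, k i %% q == t i]%N%:R.
  have -> : dval k (e t) = \sum_(c : {ffun 'I_n -> 'I_q}) \prod_(i < n)
      (((-1) ^+ (c i - t i) *+ 'C(c i, t i)) * 'C(k i, c i)%:R).
    rewrite raddf_sum; apply: eq_bigr => c _ /=.
    rewrite dvalU natr_prod -big_split /=.
    by apply: eq_bigr => i _; rewrite mnmE.
  rewrite -(bigA_distr_bigA (fun i (c : 'I_q) =>
    ((-1) ^+ (c - t i) *+ 'C(c, t i)) * 'C(k i, c)%:R)).
  under eq_bigr => i _ do rewrite (sum_bin_delta charKp) //.
  exact: prod_natb.
have q0 : (0 < q)%N := q_gt0 r (p_prime charKp).
pose red (k : 'X_{1..n}) : {ffun 'I_n -> 'I_q} :=
  [ffun i => Ordinal (ltn_pmod (k i) q0)].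
have -> : f = \sum_t dval (mn t) f *: e t.
  apply: dval_inj => k; rewrite raddf_sum (bigD1 (red k)) //= big1 => [|t tk].
    rewrite addr0 dval_is_scalable dval_e.
    rewrite (_ : [forall _, _]) ?mulr1 => [|]; last first.
      by apply/forallP => i; rewrite ffunE.
    by apply: fper => i; rewrite mnmE ffunE /= modn_mod.
  rewrite dval_is_scalable dval_e (_ : [forall _, _] = false) ?mulr0 //.
  apply: contraNF tk => /forallP kt; apply/eqP/ffunP => i.
  by apply/val_inj; rewrite ffunE /= (eqP (kt i)).
move=> a aD i; rewrite ltnNge; apply: contraTN aD => qa.
rewrite mem_dom negbK raddf_sum big1 //= => t _.
rewrite coeffZ raddf_sum big1 ?mulr0 //= => c _; rewrite coeffU.
case: eqP => [ca|_]; last by rewrite mulr0.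
by move: qa; rewrite -ca mnmE leqNgt ltn_ord.
Qed.

Lemma dval_dbin n k (i : 'I_n) c : dval k (dbin K i c) = 'C(k i, c)%:R.
Proof.
rewrite /dbin dvalU mul1r /nbin (bigD1 i) //= big1 => [|j ji].
  by rewrite muln1 mulmnE mnm1E eqxx mul1n.
by rewrite mulmnE mnm1E eq_sym (negbTE ji) bin0.
Qed.

Lemma dval_dXY n k (i : 'I_n) a : (a < q)%N ->
  dval k (dXY K q i a) = (k i %% q == a)%N%:R.
Proof.
move=> aq; rewrite -(sum_bin_delta charKp) // /dXY raddf_sum.
rewrite -(big_mkord xpredT
  (fun c => ((-1) ^+ (c - a) *+ 'C(c, a)) * 'C(k i, c)%:R)).
rewrite [RHS](@big_cat_nat _ _ _ a 0 q xpredT _ (leq0n a) (ltnW aq)) /=.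
rewrite [X in _ = X + _]big_nat_cond [X in _ = X + _]big1 ?add0r => [|c].
  by apply: eq_bigr => c _; rewrite /= dval_is_scalable dval_dbin.
by rewrite andbT /= => ca; rewrite bin_small // mul0r.
Qed.

Section Torus.
Variable m : nat.
Implicit Types (t u : ptuple m q) (k : 'X_{1..m.+1}).

Definition pt t : 'X_{1..m.+1} :=
  [multinom if unlift (yvar m) i is Some j then val (tnth t.1 j) else val t.2
     | i < m.+1].

Lemma pt_x t j : pt t (xvar j) = tnth t.1 j.
Proof. by rewrite mnmE liftK. Qed.

Lemma pt_y t : pt t (yvar m) = t.2.
Proof. by rewrite mnmE unlift_none. Qed.

Local Notation modq := (modq r (p_prime charKp)).

Definition red k : ptuple m q :=
  ([tuple modq (k (xvar i)) | i < m], modq (k (yvar m))).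

Lemma pt_red k i : pt (red k) i = k i %[mod q].
Proof.
case: (unliftP (yvar m) i) => [j ->|->].
  by rewrite pt_x tnth_mktuple /= modn_mod.
by rewrite pt_y /= modn_mod.
Qed.

Lemma red_pt t : red (pt t) = t.
Proof.
apply: ptuple_eq => [i|] /=; last by rewrite pt_y modq_small.
by rewrite tnth_mktuple pt_x modq_small.
Qed.

Lemma dval_helt k t : dval k (helt K t) = (red k == t)%:R.
Proof.
rewrite rmorphM rmorph_prod /= dval_dXY //.
under eq_bigr => i _ do rewrite dval_dXY //.
rewrite (@prod_natb K _
  (fun i => k (Defs.xvar i) %% q == tnth t.1 i)%N) -natrM mulnb.
congr (_%:R); congr nat_of_bool; apply/andP/eqP => [[/forallP kt /eqP ky]|<-].
  apply: ptuple_eq => [i|]; apply: val_inj => //=.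
  by rewrite tnth_mktuple /= (eqP (kt i)).
by split=> //; apply/forallP => i; rewrite tnth_mktuple.
Qed.

Lemma dval_helt_pt t u : dval (pt u) (helt K t) = (u == t)%:R.
Proof. by rewrite dval_helt red_pt. Qed.

Lemma in_distr_sum (I : finType) (P : pred I) (F : I -> dist K m.+1) :
  (forall i, P i -> in_distr q (F i)) -> in_distr q (\sum_(i | P i) F i).
Proof.
move=> Fq; apply/in_distrP => k k' kk; rewrite !raddf_sum.
by apply: eq_bigr => i Pi; apply: dval_modq => //; apply: Fq.
Qed.

Lemma in_distrZ x (f : dist K m.+1) : in_distr q f -> in_distr q (x *: f).
Proof.
move=> fq; apply/in_distrP => k k' kk.
by rewrite !dval_is_scalable; congr (_ * _); apply: dval_modq.
Qed.

Lemma in_distr_helt t : in_distr q (helt K t).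
Proof.
apply/in_distrP => k k' kk; rewrite !dval_helt (_ : red k = red k') //.
apply: ptuple_eq => [i|] /=; last by apply: val_inj; rewrite /= kk.
by rewrite !tnth_mktuple; apply: val_inj; rewrite /= kk.
Qed.

Lemma dval_red k (f : dist K m.+1) : in_distr q f ->
  dval k f = dval (pt (red k)) f.
Proof. by move=> fq; apply: dval_modq => // i; rewrite pt_red. Qed.

Lemma helt_inj : injective (@helt K m q).
Proof.
move=> t u /(congr1 (dval (pt t))); rewrite !dval_helt_pt eqxx.
by case: eqP => // _ /eqP; rewrite oner_eq0.
Qed.

End Torus.
End Functions.

(** * Equivalence classes of tuples *)

Section Moves.
Variables (p r m : nat).
Hypotheses (p_pr : prime p) (r_gt0 : (0 < r)%N).
Local Notation q := (p ^ r)%N.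
Local Notation modq := (modq r p_pr).
Implicit Types (t u v : ptuple m.+1 q) (i j : 'I_m.+1).

Lemma dvdn_pq : (p %| q)%N. Proof. exact: dvdn_exp. Qed.

Lemma eqn_modp a b : a = b %[mod q] -> (p %| a)%N = (p %| b)%N.
Proof.
by move=> ab; rewrite /dvdn -(modn_dvdm a dvdn_pq) ab modn_dvdm ?dvdn_pq.
Qed.

(** The step [tstep] acts on the first entry; conjugating it by a transposition
    gives the same step at position [i], see [tequiv_move]. *)
Definition move i t u : Prop :=
  [/\ forall j, j != i -> tnth t.1 j = tnth u.1 j,
      (p %| tnth t.1 i + t.2)%N
    & tnth t.1 i + t.2 = tnth u.1 i + u.2 %[mod q]].

Lemma move_dvd i t u : move i t u -> (p %| tnth u.1 i + u.2)%N.
Proof. by case=> _ pt /eqn_modp <-. Qed.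

Lemma head_entries t : head 0%N (entries t) = tnth t.1 ord0.
Proof. by case: t => [[[|x s] //= ss] b]; rewrite (tnth_nth x). Qed.

Lemma behead_eqP t u :
  reflect (forall j, j != ord0 -> tnth t.1 j = tnth u.1 j)
          (behead t.1 == behead u.1 :> seq _).
Proof.
case: t u => [t b] [u c] /=; case/tupleP: t => x t; case/tupleP: u => y u /=.
apply: (iffP eqP) => [/val_inj -> j | tu].
  by case: (unliftP ord0 j) => [k ->|-> /eqP//]; rewrite !tnthS.
congr val; apply: eq_from_tnth => j.
by have := tu (fintype.lift ord0 j) isT; rewrite !tnthS.
Qed.

Lemma tstepP t u :
  tstep p t u <-> (exists s, u = ptuple_perm s t) \/ move ord0 t u.
Proof.
rewrite /tstep !head_entries; split.
  case/orP=> [/andP[tu /eqP bb]|/and3P[/behead_eqP tu pt /eqP eq_tu]].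
    left; move: tu; rewrite perm_sym => /tuple_permP[s us]; exists s.
    by case: u us bb => [u c] /= us <-; congr (_, _); apply: val_inj.
  by right.
case=> [[s ->]|[tu pt eq_tu]]; apply/orP.
  left; rewrite /= eqxx andbT perm_sym.
  by apply/tuple_permP; exists s.
by right; apply/and3P; split=> //; [apply/behead_eqP | apply/eqP].
Qed.

Lemma tequiv_refl t : tequiv p t t. Proof. exact: connect0. Qed.

Lemma tequiv_sym t u : tequiv p t u = tequiv p u t.
Proof. by apply: sym_connect_sym => v w /=; rewrite orbC. Qed.

Lemma tequiv_trans v t u : tequiv p t v -> tequiv p v u -> tequiv p t u.
Proof. exact: connect_trans. Qed.

Lemma tequiv_step t u : tstep p t u -> tequiv p t u.
Proof. by move=> tu; apply: connect1; rewrite /= tu. Qed.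

Lemma tequiv_ind (P : ptuple m.+1 q -> Prop) t u :
  (forall v w, P v -> tstep p v w || tstep p w v -> P w) ->
  P t -> tequiv p t u -> P u.
Proof.
move=> PS Pt /connectP[s].
elim: s t Pt => [|v s IH] t Pt /=; first by move=> _ ->.
by case/andP=> tv; apply: IH; apply: PS tv.
Qed.

Lemma tequiv_invariant (T : Type) (F : ptuple m.+1 q -> T) t u :
  (forall v w, tstep p v w -> F v = F w) -> tequiv p t u -> F t = F u.
Proof.
move=> FS; apply: (@tequiv_ind (fun v => F t = F v)) => // v w ->.
by case/orP => /FS.
Qed.

Lemma tequiv_perm t s : tequiv p t (ptuple_perm s t).
Proof. by apply/tequiv_step/tstepP; left; exists s. Qed.

Lemma tequiv_move i t u : move i t u -> tequiv p t u.
Proof.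
pose s := tperm ord0 i => -[tu pt eq_tu].
apply: tequiv_trans (tequiv_perm t s) _; rewrite tequiv_sym.
apply: tequiv_trans (tequiv_perm u s) _; rewrite tequiv_sym.
apply/tequiv_step/tstepP; right; split; rewrite /= ?tnth_mktuple ?tpermL //.
move=> j j0; rewrite !tnth_mktuple; apply: tu.
by rewrite -(inj_eq (@perm_inj _ s)) tpermK tpermR.
Qed.

Definition upd i t (a b : 'I_q) : ptuple m.+1 q :=
  ([tuple if j == i then a else tnth t.1 j | j < m.+1], b).

Lemma upd_i i t a b : tnth (upd i t a b).1 i = a.
Proof. by rewrite tnth_mktuple eqxx. Qed.

Lemma upd_j i t a b j : j != i -> tnth (upd i t a b).1 j = tnth t.1 j.
Proof. by rewrite tnth_mktuple => /negbTE->. Qed.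

Lemma move_to i t (a : 'I_q) : (p %| tnth t.1 i + t.2)%N ->
  exists b, move i t (upd i t a b).
Proof.
move=> pt; exists (modq (tnth t.1 i + t.2 + (q - a))%N).
split=> // [j ji|]; first by rewrite upd_j.
rewrite upd_i /= modnDmr [(a + _)%N](_ : _ = tnth t.1 i + t.2 + q)%N.
  by rewrite modnDr.
by have := ltn_ord a; lia.
Qed.

(** The effect of [s_(i1)] on the points modulo [q]. *)
Definition shift i t : ptuple m.+1 q :=
  upd i t (modq (tnth t.1 i + q.-1)) (modq t.2.+1).

Lemma shift_sum i t :
  tnth (shift i t).1 i + (shift i t).2 = tnth t.1 i + t.2 %[mod q].
Proof.
rewrite upd_i /= modnDml modnDmr -[RHS]modnDr; congr (_ %% _)%N.
by have := q_gt0 r p_pr; lia.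
Qed.

Lemma move_shift i t : (p %| tnth t.1 i + t.2)%N -> move i t (shift i t).
Proof.
by move=> pt; split=> // [j ji|]; [rewrite upd_j | rewrite shift_sum].
Qed.

(** A move is an iterated unit shift, since each shift preserves the sum
    modulo [q] and hence its divisibility by [p]. *)
Lemma shift_invariant_move (T : Type) (F : ptuple m.+1 q -> T) :
  (forall i t, (p %| tnth t.1 i + t.2)%N -> F (shift i t) = F t) ->
  forall i t u, move i t u -> F t = F u.
Proof.
move=> FS i t u.
have [n] : exists n, tnth u.1 i + n = tnth t.1 i %[mod q].
  (* [q] is added to keep the difference of the entries nonnegative. *)
  exists (tnth t.1 i + (q - tnth u.1 i))%N; rewrite -[RHS]modnDr.
  by congr (_ %% _)%N; have := ltn_ord (tnth u.1 i); lia.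
elim: n t => [|n IH] t un tu.
  suff -> : t = u by [].
  have tui : tnth t.1 i = tnth u.1 i.
    by apply: val_inj; move: un; rewrite addn0 !modn_small.
  case: tu => [tu _ eq_tu]; apply: ptuple_eq => [j|].
    by have [->|/tu] := eqVneq j i.
  move/eqP: eq_tu; rewrite tui eqn_modDl !modn_small // => /eqP; exact: val_inj.
have pt : (p %| tnth t.1 i + t.2)%N by case: tu.
rewrite -(FS i t pt); apply: IH.
  rewrite upd_i /= modn_mod -[LHS]modnDr -[in RHS]modnDml -un modnDml.
  by congr (_ %% _)%N; have := q_gt0 r p_pr; lia.
case: tu => tu _ eq_tu; split=> [j ji||].
- by rewrite upd_j ?tu.
- by rewrite (eqn_modp (shift_sum i t)).
- by rewrite shift_sum.
Qed.

End Moves.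

(** * Special and canonical representatives *)

Section Representatives.
Variables (p r m : nat).
Hypotheses (p_pr : prime p) (r_gt0 : (0 < r)%N).
Local Notation q := (p ^ r)%N.
Implicit Types (t u v : ptuple m.+1 q) (i j : 'I_m.+1).

Lemma entriesP (P : pred nat) t :
  reflect (forall i, P (tnth t.1 i)) (all P (entries t)).
Proof.
rewrite /entries all_map; apply: (iffP all_tnthP) => /= H i; exact: (H i).
Qed.

Definition leq_ord : rel 'I_q := relpre val leq.

Definition sortt t : ptuple m.+1 q := ([tuple of sort leq_ord t.1], t.2).

Lemma sortt_sorted t : sorted leq (entries (sortt t)).
Proof.
by rewrite sorted_map; apply: sort_sorted => x y; apply: leq_total.
Qed.

Lemma sortt_perm t : exists s, sortt t = ptuple_perm s t.
Proof.
have : perm_eq (sort leq_ord t.1) t.1 by rewrite perm_sort.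
by case/tuple_permP => s ts; exists s; congr (_, _); apply: val_inj.
Qed.

Lemma tequiv_sortt t : tequiv p t (sortt t).
Proof. by have [s ->] := sortt_perm t; apply: tequiv_perm. Qed.

Lemma sortt_tnth t i : exists j, tnth (sortt t).1 i = tnth t.1 j.
Proof. by have [s ->] := sortt_perm t; exists (s i); rewrite tnth_mktuple. Qed.

(** Once [t_0 = 0] and [p] divides [b], the entry [t_0] serves as a reservoir:
    setting it to [t_j mod p] makes [t_j + b] divisible by [p], so that [t_j]
    may be replaced by its residue before [t_0] is reset to [0]. *)
Lemma tequiv_reduce1 t j : j != ord0 ->
  tnth t.1 ord0 = 0%N :> nat -> (p %| t.2)%N ->
  exists u, [/\ tequiv p t u, tnth u.1 ord0 = 0%N :> nat, (p %| u.2)%N,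
    tnth u.1 j = (tnth t.1 j %% p)%N :> nat
    & forall i, i != j -> tnth u.1 i = tnth t.1 i].
Proof.
move=> j0 t0 pt; have q0 := q_gt0 r p_pr; have p0 := prime_gt0 p_pr.
have aq : (tnth t.1 j %% p < q)%N.
  exact: leq_ltn_trans (leq_mod _ _) (ltn_ord _).
pose a := Ordinal aq; pose z := Ordinal q0.
have pt0 : (p %| tnth t.1 ord0 + t.2)%N by rewrite t0.
(* [t1] puts the residue of [t_j] in position 0, [t2] reduces [t_j], and
   [t3] resets position 0. *)
have [b1 tt1] := move_to p_pr r_gt0 a pt0; set t1 := upd _ _ _ _ in tt1.
have := move_dvd r_gt0 tt1; rewrite upd_i => pt1.
have pt1j : (p %| tnth t1.1 j + t1.2)%N.
  rewrite upd_j // (divn_eq (tnth t.1 j) p) -addnA dvdn_addr //.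
  exact: dvdn_mull.
have [b2 t12] := move_to p_pr r_gt0 a pt1j; set t2 := upd _ _ _ _ in t12.
have pt2 : (p %| tnth t2.1 ord0 + t2.2)%N.
  have := move_dvd r_gt0 t12; rewrite upd_i.
  by rewrite [tnth t2.1 ord0]upd_j 1?eq_sym // upd_i.
have [b3 t23] := move_to p_pr r_gt0 z pt2; set t3 := upd _ _ _ _ in t23.
have := move_dvd r_gt0 t23; rewrite upd_i add0n => pt3.
exists t3; split=> //; rewrite ?upd_i //.
- apply: tequiv_trans (tequiv_move tt1) _.
  exact: tequiv_trans (tequiv_move t12) (tequiv_move t23).
- by rewrite upd_j // upd_i.
- move=> i ij; have [->|i0] := eqVneq i ord0.
    by apply: val_inj; rewrite upd_i /= t0.
  by rewrite !upd_j.
Qed.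

Lemma tequiv_reduce t : tnth t.1 ord0 = 0%N :> nat -> (p %| t.2)%N ->
  exists u, [/\ tequiv p t u, tnth u.1 ord0 = 0%N :> nat, (p %| u.2)%N
    & forall i, (tnth u.1 i < p)%N].
Proof.
have [n] := ubnP #|[set j | (p <= tnth t.1 j)%N]|.
elim: n t => // n IH t tn t0 pt.
have p0 := prime_gt0 p_pr.
have [/forallP tp|] := boolP [forall i, tnth t.1 i < p]%N.
  by exists t; split=> //; apply: tequiv_refl.
rewrite negb_forall => /existsP[j]; rewrite -leqNgt => ptj.
have j0 : j != ord0 by apply: contraTneq ptj => ->; rewrite t0 -ltnNge.
have [u [tu u0 pu uj ui]] := tequiv_reduce1 j0 t0 pt.
have [|w [uw w0 pw wp]] := IH u _ u0 pu.
  rewrite -ltnS; apply: leq_trans tn; rewrite ltnS; apply: proper_card.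
  apply/properP; split.
    apply/subsetP => i; rewrite !inE.
    have [->|/ui -> //] := eqVneq i j.
    by rewrite uj leqNgt ltn_mod p0.
  by exists j; rewrite !inE // uj -ltnNge ltn_mod.
by exists w; split=> //; apply: tequiv_trans tu uw.
Qed.

Lemma tequiv_representative t :
  exists u, tequiv p t u /\ (special p u \/ canonical p u).
Proof.
have [tn|] := boolP (all (fun a => ~~ (p %| a + t.2)%N) (entries t)).
  exists (sortt t); split; first exact: tequiv_sortt.
  left; rewrite /special sortt_sorted; apply/entriesP => i.
  by have [j ->] := sortt_tnth t i; move/entriesP: tn => /(_ j).
rewrite -has_predC => /hasP[_ /mapP[x /tnthP[i ->] ->]].
rewrite /= negbK => pti.
pose u := ptuple_perm (tperm ord0 i) t.
have pu : (p %| tnth u.1 ord0 + u.2)%N by rewrite tnth_mktuple tpermL.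
have tu : tequiv p t u by apply: tequiv_perm.
have [b uv] := move_to p_pr r_gt0 (Ordinal (q_gt0 r p_pr)) pu.
have := move_dvd r_gt0 uv; set v := upd _ _ _ _ in uv *; rewrite upd_i add0n.
move=> pv; have [|w [vw w0 pw wp]] := @tequiv_reduce v _ pv.
  by rewrite upd_i.
exists (sortt w); split.
  apply: tequiv_trans tu (tequiv_trans (tequiv_move uv) _).
  exact: tequiv_trans vw (tequiv_sortt w).
right; apply/and4P; split=> //; first exact: sortt_sorted; last first.
  by apply/entriesP => j; have [k ->] := sortt_tnth w j.
have : 0%N \in entries (sortt w).
  apply/mapP; exists (tnth w.1 ord0) => //.
  by rewrite mem_sort mem_tnth.
have := sortt_sorted w; case: (entries _) => [//|y s] /=.
rewrite path_sortedE; last exact: leq_trans.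
by case/andP=> /allP sx _; rewrite inE => /orP[/eqP <- //|/sx]; rewrite leqn0.
Qed.

(** Invariant under moves: both before and after a move [t_i] and [-b] have
    the same residue modulo [p], so their contributions cancel. *)
Definition core (c : nat) t : int :=
  (\sum_i (tnth t.1 i == c %[mod p]))%N%:Z - (p %| c + t.2)%N%:Z.

Lemma core_step c t u : tstep p t u -> core c t = core c u.
Proof.
case/tstepP => [[s ->]|tu].
  rewrite /core (reindex_inj (@perm_inj _ s)) /=; congr (Posz _ - _).
  by apply: eq_bigr => i _; rewrite tnth_mktuple.
have pu := move_dvd r_gt0 tu; case: tu => tu pt _.
rewrite /core (bigD1 ord0) // [in RHS](bigD1 ord0) //=.
under eq_bigr => i i0 do rewrite (tu i i0).
have eq_core v : (p %| tnth v.1 ord0 + v.2)%N ->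
    (tnth v.1 ord0 == c %[mod p]) = (p %| c + v.2)%N.
  by move=> pv; rewrite -(eqn_modDr v.2) (eqP pv) eq_sym.
by rewrite !eq_core // !PoszD; ring.
Qed.

Definition total t : nat := (\sum_i tnth t.1 i + t.2)%N.

Lemma total_step t u : tstep p t u -> (total t %% q = total u %% q)%N.
Proof.
case/tstepP => [[s ->]|[tu _ eq_tu]].
  rewrite /total (reindex_inj (@perm_inj _ s)) /=; congr ((_ + _) %% _)%N.
  by apply: eq_bigr => i _; rewrite tnth_mktuple.
rewrite /total (bigD1 ord0) // [in RHS](bigD1 ord0) //=.
under eq_bigr => i i0 do rewrite (tu i i0).
by rewrite !(addnAC _ (\sum_(i < _ | _) _)%N) -modnDml eq_tu modnDml.
Qed.

Lemma entries_inj t u : entries t = entries u -> t.1 = u.1.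
Proof. by move/(inj_map val_inj) => tu; apply: val_inj. Qed.

(** As [p] divides [b], the correction in [core] is the same for both tuples;
    so their entries, which are their own residues, have equal
    multiplicities.  Then [total] determines [b]. *)
Lemma canonical_uniq t u :
  canonical p t -> canonical p u -> tequiv p t u -> t = u.
Proof.
case/and4P=> st _ /entriesP tp pt /and4P[su _ /entriesP up pu] tu.
have count_entries v c : (forall i, tnth v.1 i < p)%N -> (c < p)%N ->
    count_mem c (entries v) = (\sum_i (tnth v.1 i == c %[mod p]))%N.
  move=> vp cp; rewrite count_map -sum1_count big_tuple big_mkcond /=.
  by apply: eq_bigr => i _; rewrite !modn_small //; case: eqP.
have t1 : t.1 = u.1.
  apply/entries_inj/(sorted_eq leq_trans anti_leq) => //.
  apply/allP => c; rewrite mem_cat => c_tu; apply/eqP.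
  have cp : (c < p)%N.
    by case/orP: c_tu => /mapP[x /tnthP[i ->] ->]; [apply: tp | apply: up].
  rewrite !count_entries //.
  have := tequiv_invariant (core_step c) tu.
  by rewrite /core !dvdn_addl // => /addIr[].
have := tequiv_invariant total_step tu; rewrite /total t1 => /eqP.
rewrite eqn_modDl !modn_small // => /eqP tu2.
by apply: ptuple_eq => [i|]; [rewrite t1 | apply: val_inj].
Qed.

(** No entry of a special tuple can be moved, whichever way the step is read,
    and permuting keeps the tuple free of movable entries. *)
Lemma special_class t u : special p t -> tequiv p t u ->
  exists s, u = ptuple_perm s t.
Proof.
case/andP=> _ /entriesP tn.
have comp s s' v : ptuple_perm s (ptuple_perm s' v) = ptuple_perm (s * s')%g v.
  by apply: ptuple_eq => // i; rewrite !tnth_mktuple permM.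
apply: (@tequiv_ind _ _ _ (fun u => exists s, u = ptuple_perm s t)).
  move=> _ w [s ->] tw.
  have tsn i : ~~ (p %| tnth (ptuple_perm s t).1 i + (ptuple_perm s t).2)%N.
    by rewrite tnth_mktuple tn.
  case/orP: tw => /tstepP[[s' ws]|tw].
  - by exists (s' * s)%g; rewrite ws comp.
  - by case: tw => _; rewrite (negbTE (tsn _)).
  - exists (s'^-1 * s)%g; rewrite -comp ws comp mulVg.
    by apply: ptuple_eq => // i; rewrite !tnth_mktuple perm1.
  - by have := move_dvd r_gt0 tw; rewrite (negbTE (tsn _)).
by exists 1%g; apply: ptuple_eq => // i; rewrite !tnth_mktuple perm1.
Qed.

Lemma special_uniq t u : special p t -> special p u -> tequiv p t u -> t = u.
Proof.
move=> tn un /(special_class tn)[s us].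
case/andP: tn un => st _ /andP[su _].
have t1 : t.1 = u.1.
  apply/entries_inj/(sorted_eq leq_trans anti_leq) => //; apply: perm_map.
  by rewrite perm_sym; apply/tuple_permP; exists s; rewrite us.
by apply: ptuple_eq => [i|]; [rewrite t1 | rewrite us].
Qed.

Lemma special_canonical t u :
  special p t -> canonical p u -> ~~ tequiv p t u.
Proof.
move=> tn /and4P[_ u0 _ pu]; apply/negP => /(special_class tn)[s us].
case/andP: tn => _ /entriesP/(_ (s ord0)); rewrite (_ : _ + _ = u.2)%N ?pu //.
rewrite us /= -[RHS]add0n; congr (_ + _)%N.
have -> : tnth t.1 (s ord0) = tnth u.1 ord0 by rewrite us tnth_mktuple.
rewrite -head_entries; move: u0.
by rewrite /entries; case: (u.1) => -[|x w] //= _ /eqP.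
Qed.

End Representatives.

(** * The basis of the supersymmetric elements *)

Section Basis.
Variables (K : fieldType) (p r m : nat).
Hypotheses (charKp : p \in [pchar K]) (r_gt0 : (0 < r)%N).
Local Notation q := (p ^ r)%N.
Local Notation p_pr := (p_prime charKp).
Local Notation red := (red r charKp).
Local Notation shift := (shift p_pr).
Implicit Types (t u v : ptuple m.+1 q) (i j : 'I_m.+1) (f : dist K m.+2).

Lemma dval_permx f (s : 'S_m.+1) k : in_distr q f ->
  dval k (dsubst (permx s) f) = dval (pt (ptuple_perm s (red k))) f.
Proof.
move=> fq.
pose z (i : 'I_m.+2) : int := k (lift_perm (yvar m.+1) (yvar m.+1) s i).
apply: (dval_dsubst charKp (z := z) _ fq) => i; first exact: permx_int.
  by rewrite tnth_mktuple mevalXU.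
rewrite !modz_nat; congr (Posz _).
case: (unliftP (yvar m.+1) i) => [j ->|->].
  by rewrite lift_perm_lift pt_x !tnth_mktuple /= modn_mod.
by rewrite lift_perm_id pt_y /= modn_mod.
Qed.

Lemma dval_shiftx f i k : in_distr q f ->
  dval k (dsubst (shiftx i) f) = dval (pt (shift i (red k))) f.
Proof.
move=> fq; have q0 := q_gt0 r p_pr.
pose z (j : 'I_m.+2) : int := if j == xvar i then (k j)%:Z - 1
                  else if j == yvar m.+1 then (k j)%:Z + 1 else (k j)%:Z.
apply: (dval_dsubst charKp (z := z) _ fq) => j; first exact: shiftx_int.
  rewrite tnth_mktuple /z; case: ifP => _; last case: ifP => _.
  - by rewrite mevalB mevalXU meval1 intrB.
  - by rewrite mevalD mevalXU meval1 intrD.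
  - by rewrite mevalXU.
rewrite /z; case: (unliftP (yvar m.+1) j) => [l ->|->].
  rewrite (inj_eq (@lift_inj _ _)) pt_x.
  have [->|li] := eqVneq l i.
    rewrite upd_i tnth_mktuple /= -(modzDr ((k _)%:Z - 1)).
    rewrite [_ - 1 + _](_ : _ = (k (xvar i) + q.-1)%N%:Z) ?modz_nat.
      by rewrite modn_mod modnDml.
    by rewrite PoszD -subn1 -subzn //; ring.
  rewrite upd_j // eq_sym (negbTE (neq_lift _ _)) tnth_mktuple.
  by rewrite /= !modz_nat modn_mod.
rewrite (negbTE (neq_lift _ _)) eqxx pt_y /=.
rewrite -[_ + 1 in LHS]/(Posz (k _ + 1)) !modz_nat modn_mod.
by rewrite -[(k _ %% _).+1]addn1 modnDml.
Qed.

(** [f - s_(i1)(f)] is a multiple of [x_i + y_1] exactly when it vanishes at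
    the points where [x_i + y_1] does; elsewhere one divides pointwise. *)
Lemma SS_invariantP f :
  SS q f <-> in_distr q f /\
    forall t u, tequiv p t u -> dval (pt t) f = dval (pt u) f.
Proof.
have natr_xy k i : (tnth (red k).1 i + (red k).2)%:R
    = (k (xvar i) + k (yvar m.+1))%:R :> K.
  rewrite -[X in X%:R]bin1 -[X in _ = X%:R]bin1.
  apply: (bin_modq (r := r) charKp).
    by rewrite -{1}(exp1n r) ltn_exp2r // prime_gt1 // (p_prime charKp).
  by rewrite tnth_mktuple /= modnDml modnDmr.
have dvd_xy k i : (p %| tnth (red k).1 i + (red k).2)%N
    = ((k (xvar i) + k (yvar m.+1))%:R == 0 :> K).
  by rewrite (dvdn_pcharf charKp) natr_xy.
have dval_xy k i : dval k (dbin K (xvar i) 1 + dbin K (yvar m.+1) 1)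
    = (k (xvar i) + k (yvar m.+1))%:R.
  by rewrite raddfD /= !dval_dbin !bin1 natrD.
split=> [[fq fperm fPhi]|[fq finv]].
  split=> // t0 u0.
  apply: (@tequiv_invariant p r m _ (fun t => dval (pt t) f)) => t u.
  case/tstepP => [[s ->]|].
    by rewrite -[in LHS](fperm s) dval_permx ?red_pt.
  apply: (@shift_invariant_move _ _ _ p_pr r_gt0 _ (fun t => dval (pt t) f)).
  move=> {t u} i t pxy.
  rewrite -[t in RHS](red_pt charKp) -dval_red //.
  have [f' _ /(congr1 (dval (pt t)))] := fPhi i.
  rewrite /Phi raddfB /= dval_shiftx // red_pt rmorphM /= dval_xy.
  move: pxy; rewrite -{1 2}(red_pt charKp t) dvd_xy => /eqP ->.
  by rewrite mul0r => /subr0_eq.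
split=> // [s|i].
  apply: dval_inj => k; rewrite dval_permx // (dval_red charKp k fq).
  by apply: finv; rewrite tequiv_sym //; apply: tequiv_perm.
pose d t := (dval (pt t) f - dval (pt (shift i t)) f)
            / (tnth t.1 i + t.2)%:R.
have gq : in_distr q (\sum_t d t *: helt K t).
  apply: (in_distr_sum charKp) => // t _; apply: (in_distrZ charKp) => //.
  exact: (in_distr_helt charKp).
exists (\sum_t d t *: helt K t) => //.
apply: dval_inj => k; rewrite /Phi raddfB rmorphM /= dval_xy dval_shiftx //.
rewrite (dval_red charKp k fq) raddf_sum (bigD1 (red k)) //= big1 => [|t tk].
  rewrite addr0 dval_is_scalable (dval_helt charKp) eqxx mulr1.
  have [pk|pk] := boolP (p %| tnth (red k).1 i + (red k).2)%N.
    move: (pk); rewrite dvd_xy => /eqP ->; rewrite mul0r.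
    by apply/eqP; rewrite subr_eq0; apply/eqP/finv/tequiv_move/move_shift.
  move: pk; rewrite dvd_xy => pk.
  by rewrite /d natr_xy mulrC mulfVK.
by rewrite dval_is_scalable (dval_helt charKp) eq_sym (negbTE tk) mulr0.
Qed.

End Basis.

Section SSBasis.
Variables (K : fieldType) (p r m : nat).
Hypotheses (charKp : p \in [pchar K]) (r_gt0 : (0 < r)%N).
Local Notation q := (p ^ r)%N.
Local Notation p_pr := (p_prime charKp).
Local Notation index :=
  ({t : ptuple m.+1 q | special p t}
   + {t : ptuple m.+1 q | canonical p t})%type.
Implicit Types (t u : ptuple m.+1 q) (j : index).

Definition representative j : ptuple m.+1 q :=
  match j with inl t => val t | inr t => val t end.

Lemma representative_ex t : exists j, tequiv p (representative j) t.
Proof.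
have [u [tu uP]] := tequiv_representative p_pr r_gt0 t.
rewrite tequiv_sym in tu.
by case: uP => uP; [exists (inl (Sub u uP)) | exists (inr (Sub u uP))].
Qed.

Lemma representative_uniq j j' :
  tequiv p (representative j) (representative j') = (j == j').
Proof.
apply/idP/eqP => [|->]; last exact: tequiv_refl.
case: j j' => [[t tP]|[t tP]] [[u uP]|[u uP]] /= tu.
- by congr inl; apply: val_inj; apply: special_uniq tu.
- by rewrite (negbTE (special_canonical r_gt0 tP uP)) in tu.
- by rewrite tequiv_sym (negbTE (special_canonical r_gt0 uP tP)) in tu.
- by congr inr; apply: val_inj; apply: canonical_uniq tu.
Qed.

(** For a special tuple the class is its set of rearrangements, and distinct
    tuples have distinct [helt]. *)
Lemma SS_familyE j :
  SS_family K j = \sum_(u | tequiv p (representative j) u) helt K u.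
Proof.
case: j => [[t tP]|//] /=; rewrite /htilde.
rewrite [X in undup X](map_comp (@helt K m.+1 q) (fun s => ptuple_perm s t)).
rewrite undup_map_inj; last exact: (helt_inj charKp).
rewrite big_map (big_uniq _ (undup_uniq _)) /=; apply: eq_bigl => u.
rewrite mem_undup; apply/mapP/idP => [[s _ ->]|]; first exact: tequiv_perm.
by case/(special_class r_gt0 tP) => s ->; exists s; rewrite ?mem_enum.
Qed.

Lemma dval_SS_family j t :
  dval (pt t) (SS_family K j) = (tequiv p (representative j) t)%:R.
Proof.
rewrite SS_familyE raddf_sum; case: (boolP (tequiv _ _ _)) => jt.
  rewrite (bigD1 t) //= (dval_helt_pt charKp) eqxx big1 ?addr0 //= => u.
  by case/andP=> _ ut; rewrite (dval_helt_pt charKp) eq_sym (negbTE ut).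
rewrite big1 //= => u ju; rewrite (dval_helt_pt charKp).
by case: eqP ju jt => // -> ->.
Qed.

Lemma dval_SS_combination (c : index -> K) j t :
  tequiv p (representative j) t ->
  dval (pt t) (\sum_i c i *: SS_family K i) = c j.
Proof.
move=> jt; rewrite raddf_sum (bigD1 j) //= dval_is_scalable dval_SS_family jt.
rewrite mulr1 big1 ?addr0 // => i ij.
rewrite dval_is_scalable dval_SS_family.
case: (boolP (tequiv _ _ _)) => [it|_]; last by rewrite mulr0.
case/negP: ij; rewrite -representative_uniq.
by apply: tequiv_trans it _; rewrite tequiv_sym.
Qed.

Lemma in_distr_SS_combination (c : index -> K) :
  in_distr q (\sum_i c i *: SS_family K i).
Proof.
apply: (in_distr_sum charKp) => i _; apply: (in_distrZ charKp).
rewrite SS_familyE; apply: (in_distr_sum charKp) => u _.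
exact: (in_distr_helt charKp).
Qed.

(** At a point the combination takes the value of the one coefficient whose
    class contains the point; this gives both freeness and, for functions
    constant on classes, the coordinates. *)
Lemma SS_basis : is_basis (@SS K m.+1 q) (@SS_family K p m.+1 q).
Proof.
split=> [c c0 j|f].
  rewrite -(dval_SS_combination c (tequiv_refl (representative j))).
  by rewrite c0 raddf0.
rewrite (SS_invariantP charKp r_gt0); split=> [[fq finv]|[c ->]].
  exists (fun j => dval (pt (representative j)) f); apply: dval_inj => k.
  rewrite (dval_red charKp k fq).
  rewrite (dval_red charKp k (@in_distr_SS_combination _)).
  have [j jk] := representative_ex (red r charKp k).
  by rewrite (dval_SS_combination _ jk) (finv _ _ jk).
split=> [|t u tu]; first exact: in_distr_SS_combination.
have [j jt] := representative_ex t.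
by rewrite !(dval_SS_combination c (j := j)) // (tequiv_trans jt).
Qed.

End SSBasis.

Lemma has_dim_basis (K : fieldType) (V : lmodType K) (S : V -> Prop)
    (I : finType) (b : I -> V) :
  is_basis S b -> has_dim S #|I|.
Proof.
case=> b_free b_span; exists (b \o enum_val); split=> [c c0 i|v].
  rewrite -[i]enum_valK; apply: (b_free (c \o enum_rank)).
  rewrite -[RHS]c0 (reindex _ (onW_bij _ (enum_val_bij I))) /=.
  by apply: eq_bigr => j _; rewrite enum_valK.
rewrite b_span; split=> -[c ->].
  by exists (c \o enum_val); rewrite (reindex _ (onW_bij _ (enum_val_bij I))).
exists (c \o enum_rank).
rewrite [RHS](reindex _ (onW_bij _ (enum_val_bij I))) /=.
by apply: eq_bigr => j _; rewrite enum_valK.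
Qed.

(** * Counting the representatives *)

(** The enumeration of [A] is increasing, so it carries the sorted tuples over
    ['I_#|A|] to those with entries in [A]. *)
Lemma card_sorted_tuples_in n m (A : {set 'I_n}) : (0 < #|A|)%N ->
  #|[set t : m.-tuple 'I_n | sorted leq (map val t) && all (mem A) t]|
    = 'C(#|A| + m - 1, m).
Proof.
move=> A_gt0; pose f (t : m.-tuple 'I_#|A|) : m.-tuple 'I_n :=
  map_tuple (@enum_val _ (mem A)) t.
have f_inj : injective f.
  by move=> t u /(congr1 val)/= /(inj_map enum_val_inj)/val_inj.
have [x0 x0A] : exists x, x \in A by apply/set0Pn; rewrite -card_gt0.
have lt_val (i j : 'I_#|A|) : (i < j)%N -> (enum_val i < enum_val j)%N.
  have : sorted (relpre val ltn) (enum A).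
    rewrite /enum_mem -enumT; apply: sorted_filter.
      by move=> a b c; apply: ltn_trans.
    by rewrite -sorted_map val_enum_ord iota_ltn_sorted.
  rewrite !(enum_val_nth x0) => sA ij.
  by apply: (sorted_ltn_nth _ x0 sA) => //; rewrite ?inE -?cardE //;
     move=> a b c; apply: ltn_trans.
have le_val (i j : 'I_#|A|) : (enum_val i <= enum_val j)%N = (i <= j)%N.
  case: (ltngtP i j) => [/lt_val/ltnW//|/lt_val|/val_inj->]; last exact: leqnn.
  by rewrite ltnNge => /negbTE.
have sorted_f t : sorted leq (map val (f t)) = sorted leq (map val t).
  by rewrite !sorted_map; apply: eq_sorted => i j; apply: le_val.
have -> : [set t : m.-tuple 'I_n | sorted leq (map val t) && all (mem A) t]
    = f @: [set t : m.-tuple 'I_#|A| | sorted leq (map val t)].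
  apply/setP => t; rewrite inE; apply/andP/imsetP => [[st /allP tA]|[u]].
    have ft : t = f (map_tuple (enum_rank_in x0A) t).
      apply: val_inj; rewrite /= -map_comp -[LHS]map_id; apply/eq_in_map.
      by move=> x /tA xA /=; rewrite enum_rankK_in.
    by exists (map_tuple (enum_rank_in x0A) t); rewrite // inE -sorted_f -ft.
  rewrite inE => su ->; split; first by rewrite sorted_f.
  by apply/allP => _ /mapP[x _ ->]; apply: enum_valP.
rewrite card_imset // -(prednK A_gt0) card_sorted_tuples.
by congr 'C(_, _); lia.
Qed.

Lemma card_ptuple m q (P : m.-tuple 'I_q -> 'I_q -> bool) :
  #|[pred t : ptuple m q | P t.1 t.2]| = (\sum_b #|[set s | P s b]|)%N.
Proof.
rewrite -sum1_card; under [RHS]eq_bigr => b _ do rewrite -sum1_card.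
rewrite (exchange_big_dep xpredT) //= pair_big_dep /=.
by apply: eq_bigl => t; rewrite !inE.
Qed.

Lemma sum_dvdn_block p b : (0 < p)%N -> (\sum_(a < p) (p %| a + b))%N = 1%N.
Proof.
move=> p0; pose a0 := Ordinal (ltn_pmod (p - b %% p) p0).
have pa0 : (p %| a0 + b)%N.
  rewrite /dvdn /= modnDml -modnDmr subnK ?modnn //.
  exact: ltnW (ltn_pmod _ p0).
rewrite (bigD1 a0) //= pa0 big1 // => a; apply: contraNeq.
rewrite eqb0 negbK => pa; apply/eqP/val_inj; apply/eqP.
move: pa pa0; rewrite /dvdn => /eqP <-.
by rewrite eq_sym eqn_modDr !modn_small.
Qed.

Lemma sum_dvdn p n b : (0 < p)%N -> (p %| n)%N ->
  (\sum_(a < n) (p %| a + b))%N = (n %/ p)%N.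
Proof.
move=> p0 /dvdnP[{}n ->]; rewrite mulnK //.
elim: n => [|n IH]; first by rewrite big_ord0.
rewrite mulSnr big_split_ord /= IH -[RHS]addn1; congr (_ + _)%N.
rewrite -[RHS](sum_dvdn_block b p0); apply: eq_bigr => a _.
by rewrite -addnA dvdn_addr // dvdn_mull.
Qed.

Section Dimension.
Variables (p r m : nat).
Hypotheses (p_pr : prime p) (r_gt0 : (0 < r)%N).
Local Notation q := (p ^ r)%N.

Lemma card_dvdn_residues b : #|[set a : 'I_q | (p %| a + b)%N]| = (q %/ p)%N.
Proof.
rewrite -(sum_dvdn b (prime_gt0 p_pr) (dvdn_pq p r_gt0)) -sum1_card.
by rewrite big_mkcond; apply: eq_bigr => a _; rewrite inE; case: (_ %| _)%N.
Qed.

Lemma card_special :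
  #|{: {t : ptuple m q | special p t}}| = (q * 'C(q - q %/ p + m - 1, m))%N.
Proof.
rewrite card_sig (card_ptuple (fun s b => sorted leq (map val s)
  && all (fun a => ~~ (p %| a + b)%N) (map val s))).
under eq_bigr => b _.
  pose A := [set a : 'I_q | ~~ (p %| a + b)%N].
  have cardA : #|A| = (q - q %/ p)%N.
    have <- : #|~: [set a : 'I_q | (p %| a + b)%N]| = #|A|.
      by apply: eq_card => a; rewrite !inE.
    by rewrite cardsCs setCK card_ord card_dvdn_residues.
  have A_gt0 : (0 < #|A|)%N.
    by rewrite cardA subn_gt0 ltn_Pdiv ?prime_gt1 ?q_gt0.
  rewrite (_ : [set _ | _] =
    [set s : m.-tuple 'I_q | sorted leq (map val s) && all (mem A) s]).
    rewrite card_sorted_tuples_in // cardA.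
    over.
  by apply/setP => s; rewrite !inE all_map; congr (_ && _); apply: eq_all => a;
     rewrite /= inE.
by rewrite sum_nat_const card_ord.
Qed.

Lemma card_canonical :
  #|{: {t : ptuple m.+1 q | canonical p t}}| = (q %/ p * 'C(p + m - 1, m))%N.
Proof.
have p0 := prime_gt0 p_pr; have pq : (p <= q)%N.
  by rewrite dvdn_leq ?q_gt0 // dvdn_pq.
pose A := [set a : 'I_q | (a < p)%N].
have cardA : #|A| = p.
  have widen_inj : injective (widen_ord pq).
    by move=> x y /(congr1 val)/= /val_inj.
  rewrite -[RHS]card_ord -(card_imset _ widen_inj).
  apply: eq_card => a; rewrite inE.
  apply/idP/imsetP => [ap|[x _ ->]]; last exact: (ltn_ord x).
  by exists (Ordinal ap) => //; apply: val_inj.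
pose z : 'I_q := Ordinal (q_gt0 r p_pr).
pose B : {set m.+1.-tuple 'I_q} := [set s : m.+1.-tuple 'I_q |
  [&& sorted leq (map val s), head p (map val s) == 0%N
    & all (fun a => a < p)%N (map val s)]].
have cardB : #|B| = 'C(p + m - 1, m).
  transitivity 'C(#|A| + m - 1, m); last by rewrite cardA.
  rewrite -card_sorted_tuples_in; last by rewrite cardA.
  have cons_inj : injective (fun s : m.-tuple 'I_q => [tuple of z :: s]).
    by move=> s s' [] /val_inj.
  rewrite -(card_imset _ cons_inj); apply: eq_card => s.
  rewrite inE; apply/idP/imsetP => [|[s' + ->]].
    case/tupleP: s => x s /= /and3P[sx /eqP x0 /andP[_ sp]].
    exists s; last first.
      by apply: val_inj; congr (_ :: _); apply: val_inj.
    rewrite inE (path_sorted sx); move: sp; rewrite all_map => sp.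
    by apply: sub_all sp => a; rewrite /= inE.
  rewrite inE => /andP[ss /allP sA] /=; rewrite p0 /=.
  rewrite path_sortedE ?ss; last exact: leq_trans.
  rewrite andbT all_predT /=; apply/allP => _ /mapP[a /sA + ->].
  by rewrite /= inE.
rewrite card_sig (card_ptuple (fun s b => [&& sorted leq (map val s),
  head p (map val s) == 0%N, all (fun a => a < p)%N (map val s) & (p %| b)%N])).
rewrite -cardB -(card_dvdn_residues 0) -sum1_card big_distrl /= [RHS]big_mkcond.
apply: eq_bigr => b _; rewrite inE addn0 mul1n.
case: (p %| b)%N; last by apply: eq_card0 => s; rewrite inE !andbF.
by apply: eq_card => s; rewrite !inE andbT.
Qed.

End Dimension.

Theorem proposition5p10 (K : fieldType) (p m r : nat)
    (charKp : p \in [pchar K]) (m_gt0 : (0 < m)%N) (r_gt0 : (0 < r)%N) :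
  is_basis (@SS K m (p ^ r)%N) (@SS_family K p m (p ^ r)%N) /\
  has_dim (@SS K m (p ^ r)%N)
    (p ^ r * 'C(p ^ r - p ^ r %/ p + m - 1, m)
     + p ^ r %/ p * 'C(p + m - 2, m - 1))%N.
Proof.
case: m m_gt0 => [//|m] _; have basis := SS_basis m charKp r_gt0.
split=> //; have p_pr := p_prime charKp.
rewrite [(m.+1 - 1)%N]subn1 /= (_ : p + m.+1 - 2 = p + m - 1)%N.
  2: by rewrite addnS subSS.
rewrite -(card_special _ p_pr r_gt0) -(card_canonical _ p_pr r_gt0) -card_sum.
exact: has_dim_basis basis.
Qed.
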